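(* Let $X$, $Y$ be complete metric spaces and $Z\subset X$ a closed subset. Suppose that $Y$ is $\lambda$-quasiconvex for some $\lambda\geq 1$ and that the metric on $Z$ assumes only finitely many values, that is, $$n:=\#\{d(z,z') : z,z'\in Z\}<\infty,$$ where $\# S$ denotes the cardinality of a set $S$. Then any $1$-Lipschitz map $f\colon Z\to Y$ can be extended to a $2^{n+1}\lambda$-Lipschitz map $\bar{f}\colon X\to Y$.
   Context: A metric space $Y$ is $\lambda$-\emph{quasiconvex}, for some $\lambda\geq 1$, if all $y_1,y_2\in Y$ can be connected via a continuous curve $\gamma\colon[a,b]\to Y$ such that $\ell(\gamma)\leq\lambda\, d(y_1,y_2)$, where $\ell(\gamma)$ denotes the length of $\gamma$. A map $f$ between metric spaces is $L$-\emph{Lipschitz} if $d(f(x),f(y))\leq L\,d(x,y)$ for all $x,y$. Note that the value $0=d(z,z)$ is counted in $n$. *)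

(* Defs.v *)
From HB Require Import structures.
From mathcomp Require Import all_boot all_order all_algebra.
From mathcomp Require Import all_classical all_reals all_analysis.
Set Implicit Arguments.
Unset Strict Implicit.
Unset Printing Implicit Defensive.
Import Order.TTheory GRing.Theory Num.Theory.
Import numFieldNormedType.Exports.
Local Open Scope classical_set_scope.
Local Open Scope ring_scope.

(* The library's [completeType] is pointed; this version also applies to
   empty spaces. *)
Definition complete_metric (R : realType) (T : metricType R) : Prop :=
  forall u : nat -> T, cauchy (u @ \oo) -> exists l : T, u @ \oo --> l.

(* [itv_partition a b s] says that a :: s is strictly increasing and ends at b;
   compare [variation], which is restricted to real-valued functions. *)
Definition curve_length (R : realType) (Y : metricType R) (a b : R)
    (gamma : R -> Y) : \bar R :=
  ereal_sup [set (\sum_(0 <= i < size s)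
      mdist (gamma (nth b (a :: s) i)) (gamma (nth b (a :: s) i.+1)))%:E
    | s in itv_partition a b].

(* A curve on [a, b] is a total function on R of which only the values on
   [a, b] matter. *)
Definition quasiconvex (R : realType) (lambda : R) (Y : metricType R) : Prop :=
  forall y1 y2 : Y, exists (a b : R) (gamma : R -> Y),
    [/\ a <= b, {within `[a, b], continuous gamma},
        gamma a = y1, gamma b = y2
      & (curve_length a b gamma <= (lambda * mdist y1 y2)%:E)%E].

Definition subset_dist (R : realType) (X : metricType R) (Z : set X) (z z' : Z)
    : R :=
  mdist (val z) (val z').

(* The distance on the domain is a parameter, so that this applies both to maps
   on a metric space ([d := mdist]) and to maps on a subset of one
   ([d := @subset_dist R X Z]). *)
Definition lipschitz_map (R : realType) (T : Type) (d : T -> T -> R)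
    (Y : metricType R) (L : R) (f : T -> Y) : Prop :=
  forall x x' : T, mdist (f x) (f x') <= L * d x x'.

(* Main.v *)
(** Call two points of [Z] near when they are closer than half of h, where h is
    the largest positive distance exceeding twice the preceding one (the
    smallest one if there is none).  Nearness is an equivalence relation on [Z],
    its classes are at mutual distance at least h, and the diameter of [Z] is at
    most 2^(m-1) h, m being the number of positive distances.  By induction on
    m, [f] extends from each class B to a map that is constant outside the
    h/4-neighbourhood of B.  Between the distances h/4 and h/2 from B, follow a
    curve in [Y] from that constant to a common base point, parametrized by the
    distance to B.  The h/2-neighbourhoods of distinct classes are disjoint, so
    these maps glue to a map that is constant outside them.  The curves have
    length at most 2^(m-1) h lambda and are run through within h/4, hence the
    Lipschitz constant 2^(m+1) lambda at every step, with no loss of a factor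
    lambda in the induction. *)
Require Import Defs.
From HB Require Import structures.
From mathcomp Require Import all_boot all_order all_algebra.
From mathcomp Require Import all_classical all_reals all_analysis.
From mathcomp Require Import lra.
Set Implicit Arguments.
Unset Strict Implicit.
Unset Printing Implicit Defensive.
Import Order.TTheory GRing.Theory Num.Theory.
Import numFieldNormedType.Exports.
Local Open Scope classical_set_scope.
Local Open Scope ring_scope.

(** * Arc-length paths in a quasiconvex space *)

Section arc_length.
Context {R : realType} {Y : metricType R}.
Implicit Types (a b t r : R) (gamma : R -> Y).

Lemma mdist_le_curve_length a b gamma : a <= b ->
  ((mdist (gamma a) (gamma b))%:E <= curve_length a b gamma)%E.
Proof.
rewrite le_eqVlt => /predU1P[<-|ab].
  rewrite mdistxx; apply: ereal_sup_ubound; exists [::]; first by split.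
  by rewrite big_geq.
apply: ereal_sup_ubound; exists [:: b]; first exact: itv_partition1.
by rewrite /= big_nat1.
Qed.

(** A partition of [a, t] with sum above [r], followed by [t'], is a partition of [a, t'] with sum
    at most [r']; the added chord takes up at most the difference. *)
Lemma mdist_le_curve_lengthB a t t' r r' gamma : t < t' ->
  (r%:E < curve_length a t gamma)%E -> (curve_length a t' gamma <= r'%:E)%E ->
  mdist (gamma t) (gamma t') <= r' - r.
Proof.
move=> tt' /ereal_sup_gt[_ [s ats <-]]; rewrite lte_fin => rs ler'.
case: (ats) => pas lst.
have ats' : itv_partition a t' (rcons s t').
  by split; [rewrite rcons_path pas (eqP lst)|rewrite last_rcons].
have: ((\sum_(0 <= i < size (rcons s t'))
      mdist (gamma (nth t' (a :: rcons s t') i))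
        (gamma (nth t' (a :: rcons s t') i.+1)))%:E <= r'%:E)%E.
  by apply: le_trans ler'; apply: ereal_sup_ubound; exists (rcons s t').
rewrite lee_fin size_rcons big_nat_recr//= nth_rcons ltnn eqxx.
have -> : nth t' (a :: rcons s t') (size s) = t.
  rewrite -rcons_cons nth_rcons /= ltnSn (set_nth_default t)//.
  exact: itv_partition_nth_size.
(* All indices are in range, so the default of [nth] may change from [t'] to [t]. *)
rewrite (eq_big_nat _ _ (F2 := fun i =>
  mdist (gamma (nth t (a :: s) i)) (gamma (nth t (a :: s) i.+1)))).
  by move=> h; rewrite lerBrDl; apply: le_trans h; rewrite lerD2r ltW.
move=> i /andP[_ si].
by rewrite -!rcons_cons !nth_rcons [size (_ :: _)]/= !ltnS (ltnW si) si
  !(set_nth_default t t')//= ltnS ltnW.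
Qed.

Lemma within_itv_continuous_mdist a b gamma :
    {within `[a, b], continuous gamma} ->
  forall t, a <= t <= b -> forall e, 0 < e -> exists2 d, 0 < d &
    forall t', a <= t' <= b -> `|t - t'| < d -> mdist (gamma t) (gamma t') < e.
Proof.
move=> /subspace_continuousP cg t tab e e0.
have /cg : [set` `[a, b]] t by rewrite /= in_itv.
move=> /(_ _ (nbhsx_ballx (gamma t) e e0)).
rewrite /nbhs/= /within/= => -[d /= d0 H]; exists d => // t' t'ab tt'.
by have := H t' tt'; rewrite in_itv/= ballEmdist => /(_ t'ab).
Qed.

(* Arc length need not be known to vary continuously: [p r] is the value of
   [gamma] at the last time at which the length is at most [r], and continuity
   of [gamma] alone makes it 1-Lipschitz. *)
Lemma quasiconvex_path (lambda : R) (y1 y2 : Y) : quasiconvex lambda Y ->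
  exists p : R -> Y,
    [/\ forall r r', mdist (p r) (p r') <= `|r - r'|, p 0 = y1
      & forall r, lambda * mdist y1 y2 <= r -> p r = y2].
Proof.
move=> /(_ y1 y2)[a [b [gamma [ab cg <- <- len]]]].
have {}cg := within_itv_continuous_mdist cg.
(* Truncation at 0 keeps [a] in [S r] when [r] is negative. *)
pose S r := [set t | a <= t <= b /\
  (curve_length a t gamma <= (Num.max 0 r)%:E)%E].
have Sa r : S r a.
  split; first by rewrite lexx.
  apply: ge_ereal_sup => _ [s /itv_partitionxx -> <-].
  by rewrite big_geq// lee_fin le_max lexx.
have hsS r : has_sup (S r).
  by split; [exists a|exists b => t [/andP[]]].
pose tau r := sup (S r).
have tauab r : a <= tau r <= b.
  apply/andP; split; first by apply: ub_le_sup => //; case: (hsS r).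
  by apply: ge_sup; [exists a|move=> t [/andP[]]].
have near_tau r e : 0 < e -> exists2 t, S r t & tau r - e < t <= tau r.
  move=> e0; have [t St lt_t] := sup_adherent e0 (hsS r).
  by exists t => //; rewrite lt_t/= ub_le_sup//; case: (hsS r).
have lip r r' : r <= r' -> mdist (gamma (tau r)) (gamma (tau r')) <= r' - r.
  move=> rr'.
  have [max_le max_sub] : Num.max 0 r <= Num.max 0 r' /\
      Num.max 0 r' - Num.max 0 r <= r' - r.
    by case: (leP 0 r) => ?; case: (leP 0 r') => ?; split; lra.
  have : tau r <= tau r'.
    apply: ge_sup; first by exists a.
    move=> t [tab tr]; apply: ub_le_sup; first by case: (hsS r').
    by split=> //; apply: le_trans tr _; rewrite lee_fin.
  rewrite le_eqVlt => /predU1P[->|tt']; first by rewrite mdistxx subr_ge0.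
  (* The suprema need not be attained. Just after [tau r] the length exceeds [Num.max 0 r], and
     [S r'] has points arbitrarily close to [tau r']. The chord between two such points is at most
     [r' - r]; continuity makes the two end pieces small. The thirds keep the points in order. *)
  apply/ler_addgt0Pl => e e0.
  have e20 : 0 < e / 2 by lra.
  have [d d0 Hd] := cg _ (tauab r) _ e20.
  have [d' d'0 Hd'] := cg _ (tauab r') _ e20.
  have /andP[? ?] := tauab r; have /andP[? ?] := tauab r'.
  pose m := Num.min (d / 2) ((tau r' - tau r) / 3).
  have [m0 md mt] : [/\ 0 < m, m <= d / 2 & m <= (tau r' - tau r) / 3].
    by rewrite lt_min !ge_min !lexx orbT; split => //; apply/andP; split; lra.
  have m'0 : 0 < Num.min d' ((tau r' - tau r) / 3).
    by rewrite lt_min d'0/=; lra.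
  have [t' [t'ab St']] := near_tau r' _ m'0.
  rewrite ltrBlDr -ltrBlDl lt_min => /andP[/andP[t'd t't] t'r'].
  have tab : a <= tau r + m <= b by apply/andP; split; lra.
  have St : ((Num.max 0 r)%:E < curve_length a (tau r + m) gamma)%E.
    rewrite ltNge; apply/negP => le_r.
    suff: tau r + m <= tau r by lra.
    by apply: ub_le_sup; [case: (hsS r)|split].
  have tt : tau r + m < t' by lra.
  have h := mdist_le_curve_lengthB tt St St'.
  have h1 : mdist (gamma (tau r)) (gamma (tau r + m)) < e / 2.
    by apply: Hd => //; rewrite ltr_norml; apply/andP; split; lra.
  have h2 : mdist (gamma (tau r')) (gamma t') < e / 2.
    by apply: Hd' => //; rewrite ltr_norml; apply/andP; split; lra.
  have := metric_triangle (gamma (tau r)) (gamma (tau r + m)) (gamma (tau r')).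
  have := metric_triangle (gamma (tau r + m)) (gamma t') (gamma (tau r')).
  rewrite (metric_sym (gamma t') (gamma (tau r'))).
  lra.
exists (gamma \o tau); split => /=.
- move=> r r'; have [rr'|/ltW rr'] := leP r r'.
    by rewrite distrC ger0_norm ?subr_ge0//; exact: lip.
  by rewrite metric_sym ger0_norm ?subr_ge0//; exact: lip.
(* [tau 0] may exceed [a], but arbitrarily close to it are times up to which the length is 0, where
   [gamma] equals [gamma a]. *)
- apply/esym/mdist_positivity/eqP; rewrite eq_le mdist_ge0 andbT.
  apply/ler_addgt0Pl => e e0; rewrite addr0.
  have [d d0 Hd] := cg _ (tauab 0) _ e0.
  have [t [tab St] /andP[td t0]] := near_tau 0 _ d0.
  have at0 : mdist (gamma a) (gamma t) <= 0.
    rewrite -lee_fin (le_trans (mdist_le_curve_length gamma _))//.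
      by case/andP: tab.
    by rewrite (le_trans St)// maxxx.
  have h : mdist (gamma (tau 0)) (gamma t) < e.
    by apply: Hd => //; rewrite ltr_norml; apply/andP; split; lra.
  have := metric_triangle (gamma a) (gamma t) (gamma (tau 0)).
  rewrite (metric_sym (gamma t)); lra.
- move=> r lr; congr gamma; apply/eqP; rewrite eq_le.
  have /andP[_ ->] := tauab r; apply: ub_le_sup; first by case: (hsS r).
  split; first by rewrite lexx andbT.
  by rewrite (le_trans len)// lee_fin le_max lr orbT.
Qed.

End arc_length.

(** * Distance functions and gluing of Lipschitz maps *)

Section gluing.
Context {R : realType} {X Y : metricType R}.

Definition dist_to (A : set X) (x : X) : R := inf [set mdist x z | z in A].

Lemma dist_to_le (A : set X) x z : A z -> dist_to A x <= mdist x z.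
Proof.
move=> Az; apply: ge_inf; last by exists z.
by exists 0 => _ [t _ <-]; exact: mdist_ge0.
Qed.

Lemma le_dist_to (A : set X) x r : A !=set0 ->
  (forall z, A z -> r <= mdist x z) -> r <= dist_to A x.
Proof.
move=> [a Aa] h; apply: lb_le_inf; first by exists (mdist x a), a.
by move=> _ [t At <-]; exact: h.
Qed.

Lemma dist_to_ge0 (A : set X) x : A !=set0 -> 0 <= dist_to A x.
Proof. by move=> A0; apply: le_dist_to => // z _; exact: mdist_ge0. Qed.

Lemma dist_to0 (A : set X) x : A x -> dist_to A x = 0.
Proof.
move=> Ax; apply/eqP; rewrite eq_le dist_to_ge0 ?andbT; last by exists x.
by rewrite -(mdistxx x) dist_to_le.
Qed.

Lemma dist_to_lipschitz (A : set X) x x' : A !=set0 ->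
  dist_to A x <= mdist x x' + dist_to A x'.
Proof.
move=> A0; rewrite -lerBlDl; apply: le_dist_to => // z Az.
by rewrite lerBlDl (le_trans (dist_to_le _ Az))// metric_triangle.
Qed.

Lemma dist_toS (A B : set X) x : A !=set0 -> A `<=` B ->
  dist_to B x <= dist_to A x.
Proof. by move=> A0 AB; apply: le_dist_to => // z /AB; exact: dist_to_le. Qed.

Lemma le_dist_toD (A B : set X) h x x' : A !=set0 -> B !=set0 ->
  (forall z z', A z -> B z' -> h <= mdist z z') ->
  h <= dist_to A x + mdist x x' + dist_to B x'.
Proof.
move=> A0 B0 hAB; rewrite -lerBlDl; apply: le_dist_to => // z' Bz'.
rewrite lerBlDl addrC -lerBlDl -lerBlDr; apply: le_dist_to => // z Az.
have := hAB _ _ Az Bz'.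
have := metric_triangle z x z'; have := metric_triangle x x' z'.
by rewrite (metric_sym z x); lra.
Qed.

(* [beta i] dominates the distance of [G i] from being constant; its supports
   are far enough apart for the [G i] to be glued along the constant [y0]. *)
Lemma glue_lipschitz (I : Type) (P : set I) (G : I -> X -> Y)
    (beta : I -> X -> R) (L : R) (y0 : Y) : 0 <= L ->
  (forall i, P i -> lipschitz_map mdist L (G i)) ->
  (forall i x, P i -> 0 <= beta i x) ->
  (forall i x, P i -> mdist (G i x) y0 <= L * beta i x) ->
  (forall i j x x', P i -> P j -> i <> j -> 0 < beta i x -> 0 < beta j x' ->
    beta i x + beta j x' <= mdist x x') ->
  exists g : X -> Y, [/\ lipschitz_map mdist L g,
    forall i x, P i -> 0 < beta i x -> g x = G i x
  & forall x, g x = y0 \/ exists2 i, P i & g x = G i x].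
Proof.
move=> L0 lipG beta0 Gbeta sep.
have /choice[g gP] x : exists y,
    (exists i, [/\ P i, 0 < beta i x & y = G i x]) \/
    ((forall i, P i -> beta i x = 0) /\ y = y0).
  have [[i [Pi bi]]|no] := pselect (exists i, P i /\ 0 < beta i x).
    by exists (G i x); left; exists i.
  exists y0; right; split => // i Pi; apply/eqP.
  rewrite eq_le beta0// andbT leNgt; apply/negP => bi.
  by apply: no; exists i.
have gE i x : P i -> 0 < beta i x -> g x = G i x.
  move=> Pi bi; have [[j [Pj bj ->]]|[/(_ _ Pi) bi0]] := gP x; last first.
    by rewrite bi0 ltxx in bi.
  have [<-//|ij] := pselect (i = j).
  have := sep _ _ x x Pi Pj ij bi bj; rewrite mdistxx => h; exfalso; lra.
(* Where all [beta j] vanish, each [G j] takes the value [y0], so [g x'] is also [G i x']. *)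
have half x x' i : P i -> g x = G i x -> (forall j, P j -> beta j x' = 0) ->
    g x' = y0 -> mdist (g x) (g x') <= L * mdist x x'.
  move=> Pi gx b0 gx'; have := Gbeta i x' Pi; rewrite b0// mulr0 => h.
  have /mdist_positivity Gx' : mdist (G i x') y0 = 0.
    by apply/eqP; rewrite eq_le h mdist_ge0.
  by rewrite gx gx' -Gx'; exact: lipG.
exists g; split => //.
  move=> x x'; have [[i [Pi bi gx]]|[b0 gx]] := gP x;
    have [[j [Pj bj gx']]|[b0' gx']] := gP x'.
  - have [ij|ij] := pselect (i = j); first by rewrite gx gx' -ij; exact: lipG.
    have := sep _ _ x x' Pi Pj ij bi bj.
    move=> /(ler_wpM2l L0); apply: le_trans; rewrite gx gx' mulrDr.
    apply: (le_trans (metric_triangle _ y0 _)).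
    by rewrite (metric_sym y0); apply: lerD; exact: Gbeta.
  - exact: (half _ _ i).
  - by rewrite metric_sym (metric_sym x); exact: (half _ _ j).
  - by rewrite gx gx' mdistxx mulr_ge0// mdist_ge0.
by move=> x; have [[i [Pi _ gx]]|[_ gx]] := gP x; [right; exists i|left].
Qed.

(** A path from [y] to [y'] is run at speed [L] in the distance to [B], starting at distance [r]; it
    arrives by distance [r + r], its length being at most [L * r]. *)
Lemma collar_extension (lambda : R) (B : set X) (g : X -> Y) (L r : R)
    (y y' : Y) : 1 <= lambda -> quasiconvex lambda Y -> B !=set0 ->
  0 <= L -> lipschitz_map mdist L g ->
  (forall x, mdist (g x) y <= L * Num.max 0 (r - dist_to B x)) ->
  lambda * mdist y y' <= L * r ->
  exists G : X -> Y, [/\ lipschitz_map mdist L G,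
    forall x, dist_to B x <= r -> G x = g x
  & forall x, mdist (G x) y' <= L * Num.max 0 (r + r - dist_to B x)].
Proof.
move=> lambda1 qY B0 L0 lipg gy yy'.
have [p [lipp p0 p1]] := quasiconvex_path y y' qY.
have dyy' : mdist y y' <= L * r.
  by apply: le_trans yy'; rewrite ler_peMl// mdist_ge0.
pose q x := p (L * (dist_to B x - r)).
have lipq x x' : mdist (q x) (q x') <= L * `|dist_to B x - dist_to B x'|.
  apply: (le_trans (lipp _ _)).
  by rewrite -mulrBr normrM (ger0_norm L0) opprB addrA subrK.
have dB x x' : `|dist_to B x - dist_to B x'| <= mdist x x'.
  rewrite ler_norml; apply/andP; split.
    by have := dist_to_lipschitz x' x B0; rewrite metric_sym; lra.
  by have := dist_to_lipschitz x x' B0; lra.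
pose G x := if dist_to B x <= r then g x else q x.
(* Via [y], the bounds on both sides of the level [r] add up to [L] times the difference of the
   distances to [B]. *)
have cross x x' : dist_to B x <= r -> r < dist_to B x' ->
    mdist (g x) (q x') <= L * mdist x x'.
  move=> xr x'r; apply: (le_trans (metric_triangle _ y _)).
  have h1 := gy x; rewrite max_r ?subr_ge0// in h1.
  have h2 : mdist y (q x') <= L * (dist_to B x' - r).
    rewrite -p0; apply: (le_trans (lipp _ _)).
    by rewrite sub0r normrN ger0_norm// mulr_ge0// subr_ge0 ltW.
  apply: (le_trans (lerD h1 h2)); rewrite -mulrDr ler_wpM2l//.
  by apply: le_trans (dB x x'); rewrite ler_normr; apply/orP; right; lra.
exists G; split.
- move=> x x'; rewrite /G; case: ifPn => [xr|]; last rewrite -ltNge => xr;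
    (case: ifPn => [x'r|]; last rewrite -ltNge => x'r).
  + exact: lipg.
  + exact: cross.
  + by rewrite metric_sym (metric_sym x); exact: cross.
  + by apply: (le_trans (lipq _ _)); rewrite ler_wpM2l.
- by move=> x xr; rewrite /G xr.
move=> x; rewrite /G; case: ifPn => [xr|].
  apply: (le_trans (metric_triangle _ y _)).
  have h1 := gy x; rewrite max_r ?subr_ge0// in h1.
  apply: (le_trans (lerD h1 dyy')); rewrite -mulrDr ler_wpM2l// le_max.
  by apply/orP; right; lra.
rewrite -ltNge => xr.
have [x2|x2] := leP (r + r) (dist_to B x).
  rewrite /q p1; first by rewrite mdistxx mulr_ge0// le_max lexx.
  by apply: (le_trans yy'); rewrite ler_wpM2l//; lra.
rewrite max_r ?subr_ge0 ?(ltW x2)//.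
rewrite -(p1 (L * r) yy') /q; apply: (le_trans (lipp _ _)).
rewrite distrC ger0_norm; first by rewrite -mulrBr ler_wpM2l//; lra.
by rewrite -mulrBr mulr_ge0//; lra.
Qed.

End gluing.

(** * Induction on the distance scales *)

Lemma sorted_lt_le_last (R : realType) (s : seq R) x :
  sorted <%R s -> x \in s -> x <= last 0 s.
Proof.
case/lastP: s => // s y; rewrite last_rcons mem_rcons inE.
rewrite -(revK (rcons s y)) rev_sorted rev_rcons /= => + /predU1P[->//|xs].
rewrite (path_sortedE (fun _ _ _ h1 h2 => lt_trans h2 h1)).
by move=> /andP[/allP /(_ x)]; rewrite mem_rev => /(_ xs) /ltW.
Qed.

(* The gap at [k] is the last one at which the scales more than double. *)
Lemma last_scale_gap (R : realType) (s : seq R) :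
  sorted <%R s -> (forall x, x \in s -> 0 < x) -> s != [::] ->
  exists k, [/\ (k < size s)%N, forall x, x \in take k s -> 2 * x < nth 0 s k,
    forall x, x \in drop k s -> nth 0 s k <= x
  & last 0 s <= 2 ^+ (size s).-1 * nth 0 s k].
Proof.
elim/last_ind: s => // s y IH ss s0 _.
have sl := sorted_lt_le_last ss; rewrite last_rcons in sl *.
have {}ss : sorted <%R s by move: ss; rewrite -cats1 => /cat_sorted2[].
have [->|sn] := eqVneq s [::].
  exists 0%N; split => //=; last by rewrite expr0 mul1r.
  by move=> x; rewrite inE => /eqP ->.
have [x xs|k [ks tk dk lk]] := IH ss _ sn.
  by apply: s0; rewrite mem_rcons inE xs orbT.
(* If [y] is at most twice the previous scale, the gap stays and one factor 2 is spent; otherwise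
   the gap moves to [y]. *)
have [yl|yl] := leP y (2 * last 0 s).
  exists k; rewrite size_rcons nth_rcons ks; split.
  - exact: ltnW.
  - by move=> x; rewrite -cats1 take_cat ks; exact: tk.
  - move=> x; rewrite -cats1 drop_cat ks mem_cat mem_seq1.
    case/orP => [|/eqP ->]; first exact: dk.
    by apply: sl; rewrite mem_rcons inE mem_nth ?orbT.
  - rewrite (le_trans yl)//= -(prednK (leq_ltn_trans (leq0n k) ks)) exprS -mulrA.
    by rewrite ler_pM2l.
exists (size s); rewrite size_rcons nth_rcons ltnn eqxx; split => //.
- move=> x; rewrite -cats1 take_size_cat// => /(sorted_lt_le_last ss); lra.
- by move=> x; rewrite -cats1 drop_size_cat// inE => /eqP ->.
- rewrite /= ler_peMl ?exprn_ege1 ?ler1n// ltW// s0//.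
  by rewrite mem_rcons inE eqxx.
Qed.

(** The last conclusion carries the induction: an extension from a class is constant far from it, so
    a collar can be attached. As [s] need only contain the positive distances, [take k s] serves
    every class. *)
Lemma extend_from_scales (R : realType) (X Y : metricType R) (lambda : R)
    (s : seq R) (C : set X) (c : X) (f : X -> Y) :
  1 <= lambda -> quasiconvex lambda Y ->
  sorted <%R s -> (forall x, x \in s -> 0 < x) -> C c ->
  (forall z z', C z -> C z' -> mdist z z' = 0 \/ mdist z z' \in s) ->
  (forall z z', C z -> C z' -> mdist (f z) (f z') <= mdist z z') ->
  let L := 2 ^+ (size s).+1 * lambda in
  exists g : X -> Y, [/\ forall z, C z -> g z = f z, lipschitz_map mdist L g
  & forall x, mdist (g x) (f c) <= L * Num.max 0 (last 0 s / 2 - dist_to C x)].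
Proof.
move=> lambda1 qY; have lambda0 : 0 <= lambda by lra.
have [m] := ubnP (size s).
elim: m s C c => // m IH s C c /ltnSE sm ss s0 Cc Cs lipf L.
have L0 : 0 <= L by rewrite mulr_ge0// exprn_ge0.
have [s_nil|sn] := eqVneq s [::].
  exists (fun=> f c); split.
  - move=> z Cz; have [|] := Cs _ _ Cz Cc; last by rewrite s_nil.
    by move=> /mdist_positivity ->.
  - by move=> x x'; rewrite mdistxx mulr_ge0// mdist_ge0.
  - by move=> x; rewrite mdistxx mulr_ge0// le_max lexx.
have [k [ks tk dk lk]] := last_scale_gap ss s0 sn.
set h := nth 0 s k in tk dk lk.
have h0 : 0 < h by apply: s0; rewrite mem_nth.
have gap z z' : C z -> C z' ->
    [/\ 2 * mdist z z' < h & mdist z z' = 0 \/ mdist z z' \in take k s] \/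
    h <= mdist z z'.
  move=> Cz Cz'; have [d0|] := Cs _ _ Cz Cz'.
    by left; split; [rewrite d0 mulr0|left].
  rewrite -{1}(cat_take_drop k s) mem_cat => /orP[dt|/dk]; last by right.
  by left; split; [exact: tk|right].
(* Two distances below h/2 add up to less than [h], and no distance in [C] lies in [h/2, h). *)
have near_trans z z' z'' : C z -> C z' -> C z'' -> 2 * mdist z z' < h ->
    2 * mdist z' z'' < h -> 2 * mdist z z'' < h.
  move=> Cz Cz' Cz'' h1 h2; have [[]//|] := gap _ _ Cz Cz''.
  have := metric_triangle z z' z''; lra.
pose cls z := [set z' | C z' /\ 2 * mdist z z' < h].
have clsxx z : C z -> cls z z by move=> Cz; split; rewrite ?mdistxx ?mulr0.
have clsS z z' : C z -> C z' -> 2 * mdist z z' < h -> cls z `<=` cls z'.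
  move=> Cz Cz' zz' w [Cw zw]; split=> //; apply: (near_trans _ z) => //.
  by rewrite metric_sym.
pose P : set (set X) := [set B | exists2 z, C z & B = cls z].
have P0 B : P B -> B !=set0.
  by move=> [z Cz ->]; exists z; exact: clsxx.
have PC B : P B -> B `<=` C by move=> [z Cz ->] w [].
have sep B B' z z' : P B -> P B' -> B <> B' -> B z -> B' z' -> h <= mdist z z'.
  move=> [w Cw ->] [w' Cw' ->] BB' [Cz wz] [Cz' wz'].
  have [[zz' _]|//] := gap _ _ Cz Cz'; exfalso; apply: BB'.
  have ww' : 2 * mdist w w' < h.
    apply: (near_trans _ z) => //; apply: (near_trans _ z') => //.
    by rewrite metric_sym.
  by apply/seteqP; split; apply: clsS => //; rewrite metric_sym.
have /choice[G GP] B : exists g : X -> Y, P B -> [/\ lipschitz_map mdist L g,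
    forall z, B z -> g z = f z
    & forall x, mdist (g x) (f c) <= L * Num.max 0 (h / 2 - dist_to B x)].
  have [PB|] := pselect (P B); last by exists (fun=> f c).
  have [z0 Cz0 BE] := PB; have BC := PC _ PB; have B0 := P0 _ PB.
  have sz : size (take k s) = k by rewrite size_takel// ltnW.
  have [|||||z z' Bz Bz'|g [gf lipg gb]] := IH (take k s) B z0.
  - by rewrite sz (leq_trans ks).
  - exact: take_sorted.
  - by move=> x /mem_take; exact: s0.
  - by rewrite BE; exact: clsxx.
  - move=> z z' Bz Bz'.
    have [[]//|hzz'] := gap z z' (BC _ Bz) (BC _ Bz').
    move: Bz Bz'; rewrite BE => -[_ z0z] [_ z0z']; exfalso.
    by have := metric_triangle z z0 z'; rewrite (metric_sym z z0); lra.
  - by apply: lipf; exact: BC.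
  rewrite sz in lipg gb.
  have LL : 2 ^+ k.+1 * lambda <= L.
    by rewrite ler_wpM2r// ler_eXn2l ?ltr1n// ltnS ltnW.
  (* Thus [g] is constant beyond distance h/4 from [B]. For empty [take k s], [last] is its default
     0. *)
  have tkh : last 0 (take k s) <= h / 2.
    case: (take k s) tk => [|a t] tk /=; first by lra.
    by have := tk _ (mem_last a t); lra.
  have [|x||G [lipG Gg Gb]] :=
    @collar_extension _ _ _ lambda B g L (h / 4) (f z0) (f c) lambda1 qY B0 L0.
  - by move=> x x'; apply: le_trans (lipg x x') _; rewrite ler_wpM2r// mdist_ge0.
  - apply: le_trans (gb x) _; apply: ler_pM => //.
    + by rewrite mulr_ge0// exprn_ge0.
    + by rewrite le_max lexx.
    + by rewrite ge_max !le_max lexx/=; apply/orP; right; lra.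
  (* The curve joins values of the 1-Lipschitz [f] itself, so its length is at most lambda 2^(size s
     - 1) h, which is exactly [L * (h / 4)]. *)
  - have dz0c : mdist z0 c <= last 0 s.
      have [->|/(sorted_lt_le_last ss)//] := Cs _ _ Cz0 Cc.
      by case: (s) sn s0 => // a t _ /(_ _ (mem_last a t)) /ltW.
    have := le_trans (lipf _ _ Cz0 Cc) (le_trans dz0c lk).
    move=> /(ler_wpM2l lambda0) /le_trans; apply.
    have sE : (size s).-1.+1 = size s by rewrite prednK// (leq_ltn_trans _ ks).
    rewrite /L -[in leRHS]sE !exprS; lra.
  exists G => _; split => //.
    by move=> z Bz; rewrite Gg ?gf// dist_to0//; lra.
  by move=> x; have -> : h / 2 = h / 4 + h / 4 by lra.
have [B PB|B x PB|B x PB|B B' x x' PB PB' BB'|g [lipg gG g0]] :=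
  @glue_lipschitz _ X Y _ P G (fun B x => Num.max 0 (h / 2 - dist_to B x)) L
    (f c) L0.
- by have [] := GP _ PB.
- by rewrite le_max lexx.
- by have [] := GP _ PB.
(* Classes are at least [h] apart, so the depths inside their h/2-neighbourhoods add up to at most
   the distance from [x] to [x']. *)
- rewrite !lt_max !ltxx/= => b b'; rewrite (max_r (ltW b)) (max_r (ltW b')).
  have := le_dist_toD x x' (P0 _ PB) (P0 _ PB') (fun z z' => sep _ _ z z' PB PB' BB').
  lra.
exists g; split => //.
  move=> z Cz; have Pz : P (cls z) by exists z.
  have [_ + _] := GP _ Pz => <-; last exact: clsxx.
  apply: gG => //; rewrite lt_max dist_to0; last exact: clsxx.
  by apply/orP; right; lra.
move=> x; have [->|[B PB ->]] := g0 x.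
  by rewrite mdistxx mulr_ge0// le_max lexx.
have [_ _ /(_ x)] := GP _ PB => /le_trans; apply; rewrite ler_wpM2l//.
have := dist_toS x (P0 _ PB) (PC _ PB).
have : h <= last 0 s by apply: sorted_lt_le_last => //; exact: mem_nth.
by move=> hl dB; rewrite ge_max !le_max lexx/=; apply/orP; right; lra.
Qed.

Theorem corollary1p5 (R : realType) (X Y : metricType R)
    (cX : complete_metric X) (cY : complete_metric Y) (Y0 : [set: Y] !=set0)
    (Z : set X) (cZ : closed Z)
    (lambda : R) (lambda1 : 1 <= lambda) (qY : quasiconvex lambda Y)
    (n : nat) (Zn : ([set mdist z z' | z in Z & z' in Z] #= `I_n)%card)
    (f : Z -> Y) (f1 : lipschitz_map (@subset_dist R X Z) 1 f) :
  exists fbar : X -> Y,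
    (forall z : Z, fbar (val z) = f z) /\
    lipschitz_map mdist (2 ^+ n.+1 * lambda) fbar.
Proof.
have [y0 _] := Y0.
have [[c Zc]|noZ] := pselect (Z !=set0); last first.
  exists (fun=> y0); split.
    by move=> z; exfalso; apply: noZ; exists (val z); exact: set_valP.
  move=> x x'; rewrite mdistxx mulr_ge0 ?mdist_ge0// mulr_ge0 ?exprn_ge0//.
  exact: le_trans lambda1.
have lambda0 : 0 <= lambda := le_trans ler01 lambda1.
pose D := [set mdist z z' | z in Z & z' in Z].
have finD : finite_set D by apply/finite_setP; exists n.
pose s : seq R := sort <=%R [seq x <- finmap.enum_fset (fset_set D) | 0 < x].
have mem_s x : x \in s = (0 < x) && (x \in D).
  by rewrite mem_sort mem_filter -in_fset_set.
have size_s : (size s <= n)%N.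
  by rewrite size_sort size_filter (leq_trans (count_size _ _))// (card_fset_set Zn).
(* [F] makes [f] total, with the arbitrary value [y0] off [Z]. *)
pose F x := if pselect (Z x) is left Zx then f (SigSub (mem_set Zx)) else y0.
have FE (z : Z) : F (val z) = f z.
  rewrite /F; case: pselect => [Zz|[]]; last exact: set_valP.
  by congr f; apply: val_inj.
have [|x||z z' Zz Zz'|z z' Zz Zz'|g [gF lipg _]] :=
  @extend_from_scales R X Y lambda s Z c F lambda1 qY.
- rewrite sort_lt_sorted filter_uniq//; exact: finmap.fset_uniq.
- by rewrite mem_s => /andP[].
- exact: Zc.
- have := mdist_ge0 z z'; rewrite le_eqVlt => /predU1P[<-|d0]; first by left.
  by right; rewrite mem_s d0/= inE; exists z => //; exists z'.
- have := f1 (SigSub (mem_set Zz)) (SigSub (mem_set Zz')).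
  by rewrite -!FE /subset_dist/= mul1r.
exists g; split; first by move=> z; rewrite gF ?FE//; exact: set_valP.
move=> x x'; apply: le_trans (lipg x x') _.
by rewrite ler_wpM2r ?mdist_ge0// ler_wpM2r// ler_eXn2l ?ltr1n.
Qed.
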